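(* Let $d\ge 1$, let $\Gamma$ be a Fuchsian group acting on $\mathbb{R}^{d+1}$, and let $\mathcal{K}(\Gamma)$ be the set of $\Gamma$-convex bodies. The covolume is a convex function on $\mathcal{K}(\Gamma)$: for any $K_1,K_2\in\mathcal{K}(\Gamma)$ and any $t\in[0,1]$, $$\mathrm{covol}((1-t)K_1+tK_2)\leq (1-t)\,\mathrm{covol}(K_1)+t\,\mathrm{covol}(K_2).$$
   Context: Minkowski space is $\mathbb{R}^{d+1}$, $d\ge1$, with $\langle x,y\rangle_-=x_1y_1+\cdots+x_dy_d-x_{d+1}y_{d+1}$. $\mathcal{F}=\{x: \langle x,x\rangle_-<0,\ x_{d+1}>0\}$ is the set of future time-like vectors, and $\mathbb{H}^d=\{x\in\mathcal{F}:\langle x,x\rangle_-=-1\}$ is hyperbolic space. A Fuchsian group $\Gamma$ is a group of linear isometries of $(\mathbb{R}^{d+1},\langle\cdot,\cdot\rangle_-)$ preserving $\mathcal{F}$ and acting freely and cocompactly on $\mathbb{H}^d$, so that $\mathbb{H}^d/\Gamma$ is a compact manifold (in particular the action is properly discontinuous). A $\Gamma$-convex body is a nonempty closed convex set $K\subset\mathcal{F}$, $K\ne\mathcal{F}$, with $\gamma K=K$ for all $\gamma\in\Gamma$. Minkowski sum: $A+B=\{a+b: a\in A,b\in B\}$; $\lambda A=\{\lambda a:a\in A\}$ for $\lambda>0$. When a coefficient is $0$ the corresponding summand is omitted. $\mathcal{K}(\Gamma)$ is stable under Minkowski sum and multiplication by positive scalars. $\mathrm{covol}(K)$ is the volume,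 for Lebesgue measure of $\mathbb{R}^{d+1}$, of $(\mathcal{F}\setminus K)/\Gamma$, i.e. the Lebesgue measure of the intersection of $\mathcal{F}\setminus K$ with a (measurable) fundamental domain in $\mathcal{F}$, which is a cone, for the action of $\Gamma$. *)

(* Defs.v *)
From HB Require Import structures.
From mathcomp Require Import all_boot all_order all_algebra.
From mathcomp Require Import all_classical all_reals all_analysis.

Set Implicit Arguments.
Unset Strict Implicit.
Unset Printing Implicit Defensive.

Import Order.TTheory GRing.Theory Num.Theory.
Import numFieldTopology.Exports numFieldNormedType.Exports.

Local Open Scope classical_set_scope.
Local Open Scope ring_scope.

(* ['rV[R]_n] carries the sigma-algebra generated by the coordinates,
   i.e. the Borel sigma-algebra of [R^n]. *)
Definition rV_display : measure_display.
Proof. exact. Qed.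

Section measurable_rV.
Context (R : realType) (n : nat).

Definition rV_coord (i : 'I_n) (v : 'rV[R]_n) : measurableTypeR R := v 0 i.

Let rV_set0 : g_sigma_preimage rV_coord set0.
Proof. exact: sigma_algebra0. Qed.

Let rV_setC A : g_sigma_preimage rV_coord A -> g_sigma_preimage rV_coord (~` A).
Proof. exact: sigma_algebraC. Qed.

Let rV_bigcup (F : (set 'rV[R]_n)^nat) :
  (forall i, g_sigma_preimage rV_coord (F i)) ->
  g_sigma_preimage rV_coord (\bigcup_i (F i)).
Proof. exact: sigma_algebra_bigcup. Qed.

HB.instance Definition _ := @isMeasurable.Build rV_display
  'rV[R]_n (g_sigma_preimage rV_coord) rV_set0 rV_setC rV_bigcup.

End measurable_rV.

Lemma measurable_rV_coord (R : realType) n (i : 'I_n) :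
  measurable_fun [set: 'rV[R]_n] (rV_coord i).
Proof.
move=> _ Y mY; rewrite setTI; apply: sub_sigma_algebra => /=.
rewrite -bigcup_seq/=; exists i => /=; first by rewrite mem_index_enum.
by exists Y => //; rewrite setTI.
Qed.

Lemma measurable_fun_rV d (T : measurableType d) (R : realType) n
    (f : T -> 'rV[R]_n) :
  (forall i, measurable_fun [set: T] (rV_coord i \o f)) ->
  measurable_fun [set: T] f.
Proof.
move=> mf _ A mA; rewrite setTI.
have : preimage_set_system [set: T] f (g_sigma_preimage (@rV_coord R n))
    (f @^-1` A) by exists A => //; rewrite setTI.
rewrite -g_sigma_preimage_comp; apply: smallest_sub.
  exact: sigma_algebra_measurable.
move=> B; rewrite -bigcup_seq/= => -[i _ [C mC <-]].
exact: mf.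
Qed.

(* [(v, x)] is mapped to [(v_1, ..., v_n, x)]. *)
Definition rV_rcons (R : realType) n (p : 'rV[R]_n * measurableTypeR R) :
    'rV[R]_n.+1 :=
  \row_i (if unlift ord_max i is Some j then p.1 0 j else p.2).

Lemma measurable_rV_rcons (R : realType) n :
  measurable_fun setT (@rV_rcons R n).
Proof.
apply: measurable_fun_rV => i.
case: (unliftP ord_max i) => [j|] ->.
- rewrite (_ : _ \o _ = rV_coord j \o fst).
    by apply: measurableT_comp; [exact: measurable_rV_coord|exact: measurable_fst].
  by apply/funext => -[v x]; rewrite /= /rV_coord/rV_rcons mxE liftK.
- rewrite (_ : _ \o _ = snd); first exact: measurable_snd.
  by apply/funext => -[v x]; rewrite /= /rV_coord/rV_rcons mxE unlift_none.
Qed.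

(* The [n]-fold product of the one-dimensional Lebesgue measure; its values on
   boxes are given by [lebesgue_rV_box]. *)
Fixpoint lebesgue_rV (R : realType) (n : nat) : set 'rV[R]_n -> \bar R :=
  match n with
  | 0 => dirac (0 : 'rV[R]_0)
  | m.+1 => pushforward (@lebesgue_rV R m \x @lebesgue_measure R)%E
                        (@rV_rcons R m)
  end.
Arguments lebesgue_rV R n : clear implicits.

Section lebesgue_rV_measure.
Local Open Scope ereal_scope.
Context (R : realType).

Let rV_split n (v : 'rV[R]_n.+1) : 'rV[R]_n * measurableTypeR R :=
  (\row_j v 0%R (lift ord_max j), v 0%R ord_max).

Let rV_rconsK n : cancel (@rV_rcons R n) (@rV_split n).
Proof.
move=> [v x]; congr pair; last by rewrite mxE unlift_none.
by apply/rowP => j; rewrite !mxE liftK.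
Qed.

Let measurable_rV_split n : measurable_fun setT (@rV_split n).
Proof.
apply/measurable_fun_pairP; split; last exact: measurable_rV_coord.
apply: measurable_fun_rV => i.
rewrite (_ : _ \o _ = rV_coord (lift ord_max i)); first exact: measurable_rV_coord.
by apply/funext => v; rewrite /= /rV_coord mxE.
Qed.

Let lebesgue_rV_spec n :
  [/\ lebesgue_rV R n set0 = 0, (forall A, 0 <= lebesgue_rV R n A),
      semi_sigma_additive (lebesgue_rV R n) &
      sigma_finite setT (lebesgue_rV R n)].
Proof.
elim: n => [|n [m0 mge0 msig mfin]].
  have -> : lebesgue_rV R 0 = (\d_(0%R : 'rV[R]_0) : {measure set _ -> \bar R}).
    by [].
  split; [exact: measure0|by move=> A; exact: measure_ge0|
          exact: measure_semi_sigma_additive|].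
  apply: fin_num_fun_sigma_finite; first by rewrite measure0.
  by move=> A mA; exact: fin_num_measure.
pose M1 := isMeasure.Build _ _ _ (lebesgue_rV R n) m0 mge0 msig.
pose m1 : {measure set 'rV[R]_n -> \bar R} := HB.pack (lebesgue_rV R n) M1.
pose M2 := Measure_isSigmaFinite.Build _ _ _ m1 mfin.
pose m : {sigma_finite_measure set 'rV[R]_n -> \bar R} :=
  HB.pack (lebesgue_rV R n) M1 M2.
pose p : {measure set ('rV[R]_n * measurableTypeR R)%type -> \bar R} :=
  m \x @lebesgue_measure R.
have -> : lebesgue_rV R n.+1 = pushforward p (@rV_rcons R n) by [].
have mr A : measurable A -> measurable (@rV_rcons R n @^-1` A).
  by move=> mA; rewrite -[X in measurable X]setTI; exact: measurable_rV_rcons.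
split.
- by rewrite /pushforward preimage_set0 measure0.
- by move=> A; rewrite /pushforward; exact: (measure_ge0 p).
- move=> F mF tF mUF; rewrite /pushforward preimage_bigcup.
  apply: measure_semi_sigma_additive.
  + by move=> i; exact: mr.
  + apply/trivIsetP => /= i j _ _ ij; rewrite -preimage_setI.
    by move/trivIsetP : tF => /(_ _ _ _ _ ij) ->//; rewrite preimage_set0.
  + by rewrite -preimage_bigcup; exact: mr.
- have /sigma_finiteP[F [FT ndF Foo]] := sigma_finiteT m.
  have /sigma_finiteP[G [GT ndG Goo]] := sigma_finiteT (@lebesgue_measure R).
  exists (fun k => @rV_split n @^-1` (F k `*` G k)).
    apply/esym; rewrite -subTset => v _.
    have : (\bigcup_k F k) (rV_split v).1 by rewrite -FT.
    have : (\bigcup_k G k) (rV_split v).2 by rewrite -GT.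
    move=> [j _ Gj] [i _ Fi]; exists (maxn i j) => //; split.
      by move: Fi; exact/subsetPset/ndF/leq_maxl.
    by move: Gj; exact/subsetPset/ndG/leq_maxr.
  move=> k; have [mF Fk] := Foo k; have [mG Gk] := Goo k; split.
    by rewrite -[X in measurable X]setTI; apply: measurable_rV_split => //;
      exact: measurableX.
  rewrite /pushforward -comp_preimage (_ : _ \o _ = id); last first.
    by apply/funext => x /=; rewrite rV_rconsK.
  by rewrite preimage_id [ltLHS]product_measure1E// lte_mul_pinfty// ge0_fin_numE.
Qed.

HB.instance Definition _ n := isMeasure.Build _ _ _ (lebesgue_rV R n)
  (let: And4 h _ _ _ := lebesgue_rV_spec n in h)
  (let: And4 _ h _ _ := lebesgue_rV_spec n in h)
  (let: And4 _ _ h _ := lebesgue_rV_spec n in h).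

HB.instance Definition _ n := Measure_isSigmaFinite.Build _ _ _ (lebesgue_rV R n)
  (let: And4 _ _ _ h := lebesgue_rV_spec n in h).

Lemma lebesgue_rV_box n (A : 'I_n -> set (measurableTypeR R)) :
  (forall i, measurable (A i)) ->
  lebesgue_rV R n [set v | forall i, A i (v ord0 i)] =
  \prod_(i < n) lebesgue_measure (A i).
Proof.
elim: n A => [|n IHn] A mA.
  by rewrite big_ord0 /= diracE mem_set//= => -[].
rewrite big_ord_recr/= -IHn// /pushforward.
have mB : measurable [set v : 'rV[R]_n | forall i, A (widen_ord (leqnSn n) i) (v ord0 i)].
  rewrite (_ : [set _ | _] =
    \bigcap_(i in setT) (rV_coord i @^-1` A (widen_ord (leqnSn n) i))); last first.
    by apply/seteqP; split => v /= h i; [move=> _|]; exact: h.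
  apply: fin_bigcap_measurable => // i _.
  by rewrite -[X in measurable X]setTI; exact: measurable_rV_coord.
rewrite -product_measure1E//; congr (_ _).
have wl i : widen_ord (leqnSn n) i = lift ord_max i.
  by apply/val_inj; rewrite /= /bump leqNgt ltn_ord.
apply/seteqP; split => -[v x] /=.
  move=> h; split; last by have := h ord_max; rewrite mxE unlift_none.
  by move=> i /=; have := h (lift ord_max i); rewrite mxE liftK /= wl.
move=> [/= hv hx] i; rewrite mxE; case: (unliftP ord_max i) => [j|] -> //=.
by rewrite -wl; exact: hv.
Qed.

End lebesgue_rV_measure.

Section minkowski.
Context (R : realType) (d : nat).
Local Notation V := 'rV[R]_d.+1.
Implicit Types (x y : V) (K A B D : set V) (Gamma : set (V -> V)).

Definition minkowski_form x y : R :=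
  \sum_(i < d.+1 | i != ord_max) x 0 i * y 0 i - x 0 ord_max * y 0 ord_max.

Definition future : set V := [set x | minkowski_form x x < 0 /\ 0 < x 0 ord_max].

Definition hyperbolic : set V := [set x | future x /\ minkowski_form x x = -1].

(* A group of linear isometries, as a set of maps.  Free and cocompact actions
   of non-discrete groups exist, hence the clause on proper discontinuity. *)
Record fuchsian_group Gamma : Prop := {
  fuchsian_id : Gamma id ;
  fuchsian_comp : forall g h, Gamma g -> Gamma h -> Gamma (g \o h) ;
  fuchsian_inv : forall g, Gamma g -> exists2 h, Gamma h & cancel g h /\ cancel h g ;
  fuchsian_linear : forall g, Gamma g -> linear g ;
  fuchsian_isometry : forall g, Gamma g ->
    forall x y, minkowski_form (g x) (g y) = minkowski_form x y ;
  fuchsian_future : forall g, Gamma g -> g @` future = future ;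
  fuchsian_free : forall g x, Gamma g -> hyperbolic x -> g x = x -> g = id ;
  fuchsian_cocompact : exists C : set V,
    [/\ compact C, C `<=` hyperbolic &
        hyperbolic `<=` \bigcup_(g in Gamma) (g @` C)] ;
  fuchsian_discontinuous : forall C : set V, compact C -> C `<=` hyperbolic ->
    finite_set [set g | Gamma g /\ (g @` C) `&` C !=set0]
}.

Record convex_body Gamma K : Prop := {
  convex_body_nonempty : K !=set0 ;
  convex_body_closed : closed K ;
  convex_body_convex : convex_set K ;
  convex_body_future : K `<=` future ;
  convex_body_proper : K <> future ;
  convex_body_invariant : forall g, Gamma g -> g @` K = K
}.

Definition minkowski_sum A B : set V := [set a + b | a in A & b in B].

(* For nonempty [A], [dilate 0 A = [set 0]] is neutral for [minkowski_sum]: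
   a summand with coefficient [0] is omitted. *)
Definition dilate (lambda : R) A : set V := [set lambda *: a | a in A].

(* Translates are only required to tile [future] up to Lebesgue-null sets. *)
Record cone_fundamental_domain Gamma D : Prop := {
  domain_measurable : measurable D ;
  domain_future : D `<=` future ;
  domain_cone : forall (lambda : R) x, 0 < lambda -> D x -> D (lambda *: x) ;
  domain_disjoint : forall g, Gamma g -> g <> id ->
    (lebesgue_rV R d.+1).-negligible (D `&` (g @` D)) ;
  domain_cover :
    (lebesgue_rV R d.+1).-negligible (future `\` \bigcup_(g in Gamma) (g @` D))
}.

(* The volume of [(future `\` K) / Gamma] for [K] invariant under [Gamma],
   computed in a fundamental domain [D] of [Gamma]. *)
Definition covolume D K : \bar R := lebesgue_rV R d.+1 ((future `\` K) `&` D).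

End minkowski.

(* Main.v *)
Require Import Defs.
From mathcomp Require Import all_boot all_order all_algebra.
From mathcomp Require Import all_classical all_reals all_analysis.
From mathcomp Require Import measurable_realfun ring.
Import Order.TTheory GRing.Theory Num.Theory.
Import numFieldTopology.Exports numFieldNormedType.Exports.
Local Open Scope classical_set_scope.
Local Open Scope ring_scope.

(** The covolume is an integral over rays, and it is already convex ray by ray.

    Write a point of the upper half space as [r *: (y, 1)] with [r > 0] and [y]
    in R^d.  In these coordinates Lebesgue measure is [r ^ d dr dy]
    ([lebesgue_rV_rays]; it follows from Tonelli's theorem and the homogeneity
    [lebesgue_rV_homothety] of the horizontal slices).  As the fundamental domain
    [D] is a cone, the covolume of [K] is the integral, over the [y] with
    [(y, 1)] in [D], of the mass for [r ^ d dr] of the set of [r > 0] such that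
    [r *: (y, 1)] is not in [K].

    Fix a ray, on which [K1] and [K2] cut out convex sets of parameters, that is
    intervals.  If one of them is bounded, possibly empty, the mass of its
    complement is infinite, so the right-hand side of the inequality is infinite
    when [0 < t < 1].  Otherwise the complements are initial intervals ending at
    some [rho1] and [rho2], of mass [rho ^ (d + 1) / (d + 1)].  The Minkowski
    combination contains the combinations of points of [K1] and [K2] taken on the
    same ray, so its complement ends at or before [(1 - t) * rho1 + t * rho2]; the
    convexity of [rho ^ (d + 1)] gives the inequality on the ray
    ([radial_mass_convex]), and integration over [y] gives it for covolumes.

    Measurability needs some care: closed sets belong to the sigma-algebra
    generated by the coordinates, and a combination of closed sets is a countable
    union of compact sets.  The values [t = 0] and [t = 1] are treated apart,
    since there the infinite masses above get a zero coefficient. *)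

Set Implicit Arguments.
Unset Strict Implicit.
Unset Printing Implicit Defensive.

(** * Measurability in R^n *)

Lemma measurable_preimageT d1 d2 (T1 : measurableType d1)
    (T2 : measurableType d2) (f : T1 -> T2) (A : set T2) :
  measurable_fun setT f -> measurable A -> measurable (f @^-1` A).
Proof. by move=> mf mA; rewrite -[X in measurable X]setTI; exact: mf. Qed.

Lemma measurable_rV_ball (R : realType) n (x : 'rV[R]_n) (e : R) :
  measurable [set y : 'rV[R]_n | forall i, ball (x 0 i) e (y 0 i)].
Proof.
rewrite (_ : [set _ | _] =
    \bigcap_(i in setT) (rV_coord i @^-1` ball (x 0 i) e)); last first.
  by apply/seteqP; split => v /= h i; [move=> _|]; exact: h.
apply: fin_bigcap_measurable => // i _.
apply: measurable_preimageT; first exact: measurable_rV_coord.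
by apply: open_measurable; exact: ball_open.
Qed.

(** An open set is the union of the countably many cubes with rational centre and
    inverse integer radius that it contains. *)
Lemma open_measurable_rV (R : realType) n (U : set 'rV[R]_n) :
  open U -> measurable U.
Proof.
move=> oU.
pose B (p : 'rV[rat]_n * nat) := [set y : 'rV[R]_n | forall i,
  ball ((map_mx ratr p.1 : 'rV[R]_n) 0 i) p.2.+1%:R^-1 (y 0 i)].
rewrite (_ : U = \bigcup_p (if `[< B p `<=` U >] then B p else set0)).
  apply: countable_bigcupT_measurable => // p; case: ifP => // _.
  exact: measurable_rV_ball.
apply/seteqP; split => [x Ux|x [p _]]; last first.
  by case: ifPn => // /asboolP h; exact: h.
have /nbhs_ballP[e /= e0 xeU] : nbhs x U by exact: open_nbhs_nbhs.
have [k ke] : exists k, k.+1%:R^-1 < e / 2 :> R.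
  have [k _ ke] := near_infty_natSinv_lt (PosNum (divr_gt0 e0 (ltr0n R 2))).
  by exists k; exact: (ke k (leqnn _)).
have qx i : exists q : rat, ball (x 0 i) k.+1%:R^-1 (ratr q : R).
  have [z [bq [q _ qE]]] :
      ball (x 0 i) (k.+1%:R^-1 : R) `&` (ratr @` [set: rat]) !=set0.
    apply: dense_rat; last exact: ball_open.
    by exists (x 0 i); apply: ballxx; rewrite invr_gt0.
  by exists q; rewrite qE.
pose q := \row_i projT1 (cid (qx i)).
have qP i : ball (x 0 i) k.+1%:R^-1 ((map_mx ratr q : 'rV[R]_n) 0 i).
  by rewrite !mxE; case: cid.
have BU : B (q, k) `<=` U.
  move=> y By; apply: xeU; split => // j i; rewrite (ord1 j).
  apply: (@le_ball _ _ _ (k.+1%:R^-1 + k.+1%:R^-1)).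
    by rewrite [leRHS]splitr lerD ?ltW.
  by apply: ball_triangle (qP i) (By i).
by exists (q, k) => //; case: ifPn => [_ i|/asboolP//]; exact/ball_sym/qP.
Qed.

Lemma closed_measurable_rV (R : realType) n (A : set 'rV[R]_n) :
  closed A -> measurable A.
Proof.
move=> cA; rewrite -[A]setCK; apply: measurableC.
by apply: open_measurable_rV; exact: closed_openC.
Qed.

(** A sum of closed sets need not be closed, but it is a countable union of
    compact sets: cut both summands by the cubes of half-side [k]. *)
Lemma measurable_minkowski_comb (R : realType) n (A B : set 'rV[R]_n.+1)
    (a b : R) :
  closed A -> closed B ->
  measurable (minkowski_sum (dilate a A) (dilate b B)).
Proof.
move=> cA cB.
pose box (k : nat) := [set v : 'rV[R]_n.+1 | forall i,
  `[(- k%:R : R), k%:R]%classic (v ord0 i)].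
pose f (z : 'rV[R]_n.+1 * 'rV[R]_n.+1) := a *: z.1 + b *: z.2.
have cbox k : compact (box k).
  apply: (@rV_compact _ _ (fun=> `[(- k%:R : R), k%:R]%classic)) => i.
  exact: segment_compact.
have inbox (v : 'rV[R]_n.+1) : exists k, forall j, (k <= j)%N -> box j v.
  have [k kv] : exists k : nat, `|v| <= k%:R.
    by exists (Num.trunc `|v|).+1; rewrite ltW// truncnS_gt.
  exists k => j kj i /=; rewrite in_itv/= -ler_norml.
  have : `|v 0 i| <= `|v|.
    rewrite [leRHS]/Num.norm/= mx_normrE.
    by apply: (le_bigmax _ (fun ij => `|v ij.1 ij.2|) (0, i)).
  by move=> /le_trans; apply; rewrite (le_trans kv)// ler_nat.
have cf : continuous f.
  move=> z; apply: cvgD; apply: cvgZ => //; try exact: cvg_cst.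
    exact: cvg_fst.
  exact: cvg_snd.
rewrite (_ : minkowski_sum _ _ =
    \bigcup_k (f @` ((box k `&` A) `*` (box k `&` B)))).
  apply: bigcupT_measurable => k; apply: closed_measurable_rV.
  apply: compact_closed; first exact: norm_hausdorff.
  apply: continuous_compact; first exact: continuous_subspaceT.
  by apply: compact_setX; apply: compact_closedI.
apply/seteqP; split => [z [_ [x Ax <-] [_ [y By <-] <-]]|z [k _] [[x y]]].
  have [i hi] := inbox x; have [j hj] := inbox y.
  exists (maxn i j) => //; exists (x, y) => //; split; split => //.
    by apply: hi; exact: leq_maxl.
  by apply: hj; exact: leq_maxr.
move=> [[_ /= Ax] [_ /= By]] <-; rewrite /f /=.
by exists (a *: x); [exists x|exists (b *: y); [exists y|]].
Qed.

(** * The inequality on one ray *)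

Section ray.
Context (R : realType).
Implicit Types (a b t : R) (n : nat).
Local Notation mu := (@lebesgue_measure R).

Lemma convex_exprn n a b t : 0 <= t -> t <= 1 -> 0 <= a -> 0 <= b ->
  ((1 - t) * a + t * b) ^+ n <= (1 - t) * a ^+ n + t * b ^+ n.
Proof.
move=> t0 t1 a0 b0; elim: n => [|n IHn].
  by rewrite !expr0 !mulr1 subrK.
rewrite exprS.
have m0 : 0 <= (1 - t) * a + t * b by rewrite addr_ge0 ?mulr_ge0// subr_ge0.
apply: (le_trans (ler_wpM2l m0 IHn)); rewrite -subr_ge0 !exprS.
(* Chebyshev's identity for the two-point mean with weights [1 - t] and [t] *)
rewrite (_ : _ - _ = t * (1 - t) * ((a - b) * (a ^+ n - b ^+ n))); last by ring.
apply: mulr_ge0; first by rewrite mulr_ge0// subr_ge0.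
have [ab|ba] := leP a b.
  by apply: mulr_le0; rewrite subr_le0// lerXn2r.
by apply: mulr_ge0; rewrite subr_ge0 ?lerXn2r ?ltW// ?qualifE/=.
Qed.

Lemma measurable_exprn_EFin n (N : set (measurableTypeR R)) :
  measurable_fun N (fun r : R => (r ^+ n)%:E).
Proof. by apply/measurable_EFinP; apply: measurable_funTS. Qed.

Lemma integral_exprn n a : 0 <= a ->
  (\int[mu]_(r in `]0%R, a%R[) (r ^+ n)%:E = (a ^+ n.+1 / n.+1%:R)%:E)%E.
Proof.
rewrite le_eqVlt => /predU1P[<-|a0].
  by rewrite set_itvoo0 integral_set0 expr0n mul0r.
have mf := @measurable_exprn_EFin n.
rewrite integral_itv_bndo_bndc; last exact: mf.
rewrite integral_itv_obnd_cbnd; last exact: mf.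
rewrite (@continuous_FTC2 _ _ (fun r : R => r ^+ n.+1 / n.+1%:R))//.
- by rewrite expr0n mul0r sube0.
- by apply: continuous_subspaceT => x; exact: exprn_continuous.
- have cF : continuous (fun r : R => r ^+ n.+1 / n.+1%:R).
    by move=> x; apply: cvgMl; exact: exprn_continuous.
  split=> [x _||].
  + by apply: derivableM => //; exact: exprn_derivable.
  + by apply: cvg_at_right_filter; exact: cF.
  + by apply: cvg_at_left_filter; exact: cF.
- move=> x _; rewrite derive1Mr; last exact: exprn_derivable.
  by rewrite exp_derive1 /= /GRing.scale/= mulrAC mulfV ?mul1r// pnatr_eq0.
Qed.

(** The density [r ^ n] is the Jacobian of [(y, r) |-> r *: (y, 1)] on R^n x R. *)
Definition radial_mass n (N : set R) : \bar R :=
  (\int[mu]_(r in N `&` `]0%R, +oo[) (r ^+ n)%:E)%E.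

Let exprn_EFin_ge0 n (N : set R) (r : R) :
  (N `&` `]0%R, +oo[) r -> (0 <= (r ^+ n)%:E)%E.
Proof.
by case=> _ /=; rewrite in_itv/= andbT lee_fin => /ltW; exact: exprn_ge0.
Qed.

Lemma radial_mass_ge0 n N : (0 <= radial_mass n N)%E.
Proof. by apply: integral_ge0 => x; exact: exprn_EFin_ge0. Qed.

Lemma le_radial_mass n (A B : set (measurableTypeR R)) :
  measurable A -> measurable B ->
  A `&` `]0%R, +oo[ `<=` B -> (radial_mass n A <= radial_mass n B)%E.
Proof.
move=> mA mB AB; apply: ge0_subset_integral.
- exact: measurableI.
- exact: measurableI.
- exact: measurable_exprn_EFin.
- exact: exprn_EFin_ge0.
- by move=> x [Ax x0]; split => //; exact: AB.
Qed.

Lemma radial_mass_itv n a : 0 <= a ->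
  (radial_mass n `]0%R, a%R[ = (a ^+ n.+1 / n.+1%:R)%:E)%E.
Proof.
move=> a0; rewrite -integral_exprn// /radial_mass; congr (integral _ _ _).
apply/seteqP; split => x /=; rewrite !in_itv/= ?andbT; first by case.
by move=> /andP[-> ->].
Qed.

Lemma radial_mass_infty n (N : set (measurableTypeR R)) M : measurable N ->
  `]M, +oo[ `<=` N -> radial_mass n N = +oo%E.
Proof.
move=> mN MN.
(* beyond [c] the density is at least 1 *)
pose c := Num.max M 1.
apply/eqP; rewrite -leye_eq.
have c1 : 1 <= c by rewrite le_max lexx orbT.
apply: (@le_trans _ _ (radial_mass n `]c, +oo[)); last first.
  apply: le_radial_mass => // x [/= + _]; rewrite in_itv/= andbT => cx.
  by apply: MN; rewrite /= in_itv/= andbT (le_lt_trans _ cx)// le_max lexx.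
rewrite /radial_mass setIidl; last first.
  move=> x/=; rewrite !in_itv/= !andbT; apply: le_lt_trans.
  by rewrite (le_trans _ c1).
apply: (@le_trans _ _ (\int[mu]_(r in `]c%R, +oo[) 1)%E).
  have h : (mu `]c, +oo[%classic = +oo)%E by rewrite lebesgue_measure_itv/= ltry.
  by rewrite integral_cst// mul1e [leRHS]h.
apply: ge0_le_integral => //.
- exact: measurable_exprn_EFin.
- move=> x /=; rewrite in_itv/= andbT => cx; rewrite lee_fin exprn_ege1//.
  by rewrite (le_trans c1)// ltW.
Qed.

Lemma convex_unbounded_upward (I : set R) :
  (forall x y s, I x -> I y -> 0 < s -> s < 1 -> I (s * x + (1 - s) * y)) ->
  (forall M, exists2 x, I x & M < x) ->
  forall x y, I x -> x < y -> I y.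
Proof.
move=> cI uI x y Ix xy.
have [z Iz yz] := uI y.
have xz : 0 < z - x by rewrite subr_gt0 (lt_trans xy).
pose s := (z - y) / (z - x).
have -> : y = s * x + (1 - s) * z by rewrite /s; field; rewrite gt_eqF.
apply: cI => //; rewrite /s; first by rewrite divr_gt0// subr_gt0.
by rewrite ltr_pdivrMr// mul1r ltrD2l ltrN2.
Qed.

(** If [I] is bounded, its complement contains a half-line, on which the density
    is not integrable; if not, [I] is upward closed and [rho] is its infimum. *)
Lemma radial_mass_dichotomy n (I : set (measurableTypeR R)) : measurable I ->
  (forall x y s, I x -> I y -> 0 < s -> s < 1 -> I (s * x + (1 - s) * y)) ->
  I `<=` `]0, +oo[ ->
  radial_mass n (~` I) = +oo%E \/
  exists rho, [/\ 0 <= rho, forall r, rho < r -> I r &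
    ((rho ^+ n.+1 / n.+1%:R)%:E <= radial_mass n (~` I))%E].
Proof.
move=> mI cI I0.
have [[M uM]|nM] := pselect (exists M, forall x, I x -> x <= M).
  left; apply: (@radial_mass_infty _ _ M); first exact: measurableC.
  by move=> x/=; rewrite in_itv/= andbT => Mx /uM; rewrite leNgt Mx.
right.
have uI M : exists2 x, I x & M < x.
  apply: contrapT => h; apply: nM; exists M => x Ix.
  by rewrite leNgt; apply/negP => Mx; apply: h; exists x.
have hI : has_inf I.
  split; first by have [x Ix _] := uI 0; exists x.
  by exists 0 => x /I0/=; rewrite in_itv/= andbT => /ltW.
exists (inf I).
have rho0 : 0 <= inf I.
  by apply: lb_le_inf (hI.1) _ => x /I0/=; rewrite in_itv/= andbT => /ltW.
split => //.
- move=> r Ir; have [x Ix xr] : exists2 x, I x & x < r.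
    have e0 : 0 < r - inf I by rewrite subr_gt0.
    have [x Ix xr] := inf_adherent e0 hI.
    by exists x => //; move: xr; rewrite addrC subrK.
  exact: convex_unbounded_upward xr.
- rewrite -radial_mass_itv//; apply: le_radial_mass => //.
    exact: measurableC.
  move=> x [/=]; rewrite in_itv/= => /andP[_ xr] _ Ix.
  by have := ge_inf hI.2 Ix; rewrite leNgt xr.
Qed.

(** [I1], [I2] and [I] are the traces on a ray of two convex sets and of their
    Minkowski combination. *)
Lemma radial_mass_convex n (I1 I2 I : set (measurableTypeR R)) t :
  0 < t -> t < 1 ->
  measurable I1 -> measurable I2 -> measurable I ->
  (forall x y s, I1 x -> I1 y -> 0 < s -> s < 1 -> I1 (s * x + (1 - s) * y)) ->
  (forall x y s, I2 x -> I2 y -> 0 < s -> s < 1 -> I2 (s * x + (1 - s) * y)) ->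
  I1 `<=` `]0, +oo[ -> I2 `<=` `]0, +oo[ ->
  (forall x y, I1 x -> I2 y -> I ((1 - t) * x + t * y)) ->
  (radial_mass n (~` I) <=
    (1 - t)%:E * radial_mass n (~` I1) + t%:E * radial_mass n (~` I2))%E.
Proof.
move=> t0 t1 m1 m2 m c1 c2 p1 p2 h.
have t1' : 0 < 1 - t by rewrite subr_gt0.
have [->|[r1 [r10 u1 l1]]] := radial_mass_dichotomy n m1 c1 p1.
  rewrite gt0_muley ?lte_fin// addye ?leey//.
  rewrite gt_eqF// (lt_le_trans ltNy0)//.
  by rewrite mule_ge0 ?radial_mass_ge0// lee_fin ltW.
have [->|[r2 [r20 u2 l2]]] := radial_mass_dichotomy n m2 c2 p2.
  rewrite gt0_muley ?lte_fin// addey ?leey//.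
  rewrite gt_eqF// (lt_le_trans ltNy0)//.
  by rewrite mule_ge0 ?radial_mass_ge0// lee_fin ltW.
pose rho := (1 - t) * r1 + t * r2.
have rho0 : 0 <= rho by rewrite addr_ge0// mulr_ge0// ltW.
apply: (@le_trans _ _ (rho ^+ n.+1 / n.+1%:R)%:E).
  (* the end point [rho] may be missing from [I]: use the interval closed there *)
  rewrite -integral_exprn// integral_itv_bndo_bndc; last first.
    exact: measurable_exprn_EFin.
  apply: ge0_subset_integral => //.
  - by apply: measurableI => //; exact: measurableC.
  - exact: measurable_exprn_EFin.
  - move=> x /=; rewrite in_itv/= => /andP[/ltW x0 _].
    by rewrite lee_fin exprn_ge0.
  - move=> r /= [nI]; rewrite !in_itv/= andbT => -> /=.
    rewrite leNgt; apply/negP => rr; apply: nI.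
    (* move both end points by the same amount *)
    have -> : r = (1 - t) * (r1 + (r - rho)) + t * (r2 + (r - rho)).
      by rewrite /rho; ring.
    by apply: h; [apply: u1|apply: u2]; rewrite ltrDl subr_gt0.
apply: (@le_trans _ _ ((1 - t)%:E * (r1 ^+ n.+1 / n.+1%:R)%:E +
                       t%:E * (r2 ^+ n.+1 / n.+1%:R)%:E)%E).
  rewrite -!EFinM -EFinD lee_fin !mulrA -mulrDl ler_pM2r ?invr_gt0 ?ltr0n//.
  by apply: convex_exprn => //; exact: ltW.
by apply: leeD; apply: lee_wpmul2l; rewrite // lee_fin ltW.
Qed.

End ray.

(** * Lebesgue measure and homotheties *)

Section homothety.
Context (R : realType).
Local Notation leb := (lebesgue_rV R).

Lemma lebesgue_measure_homothety (c : R) (A : set (measurableTypeR R)) : 0 < c ->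
  measurable A ->
  lebesgue_measure A = (c%:E * lebesgue_measure ((fun x => (c * x)%R) @^-1` A))%E.
Proof.
move=> c0 mA.
pose f : measurableTypeR R -> measurableTypeR R := fun x => c * x.
have mf : measurable_fun setT f by exact: mulrl_measurable.
pose p : {measure set (measurableTypeR R) -> \bar R} :=
  pushforward (@lebesgue_measure R) f.
pose q : {measure set (measurableTypeR R) -> \bar R} :=
  mscale (NngNum (ltW c0)) (p mf).
rewrite (@lebesgue_measure_unique _ q)// => _ [[a b] _ <-] /=.
rewrite /mscale/= /pushforward.
have -> : f @^-1` `]a, b] = `]a / c, b / c]%classic.
  apply/seteqP; split => x /=; rewrite !in_itv/= ltr_pdivrMr// ler_pdivlMr//;
    by rewrite mulrC.
rewrite !lebesgue_measure_itv/= !lte_fin ltr_pM2r ?invr_gt0//.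
case: ifPn => _; last by rewrite mule0.
by rewrite -!EFinB -EFinM -mulrBl mulrC divfK// gt_eqF.
Qed.

Lemma measurable_fun_homothety n (c : R) :
  measurable_fun setT (fun v : 'rV[R]_n => c *: v).
Proof.
apply: measurable_fun_rV => i.
rewrite (_ : _ \o _ = (fun v => c * rV_coord i v)); last first.
  by apply/funext => v /=; rewrite /rV_coord mxE.
apply: (@measurableT_comp _ _ _ _ _ _
  (fun x : measurableTypeR R => (c * x : measurableTypeR R))).
  exact: mulrl_measurable.
exact: measurable_rV_coord.
Qed.

Lemma rV_rconsZ n (c : R) (p : 'rV[R]_n * measurableTypeR R) :
  c *: rV_rcons p = rV_rcons (c *: p.1, c * p.2).
Proof.
apply/rowP => i; rewrite !mxE; case: (unlift ord_max i) => //= j.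
by rewrite mxE.
Qed.

(** By induction on the dimension: the rescaled measure is a product on
    rectangles, hence is the product measure. *)
Lemma lebesgue_rV_homothety n (c : R) (A : set 'rV[R]_n) : 0 < c ->
  measurable A ->
  leb n A = ((c ^+ n)%:E * leb n ((fun v => (c *: v)%R) @^-1` A))%E.
Proof.
move=> c0; elim: n A => [|n IHn] A mA.
  have -> : (fun v : 'rV[R]_0 => c *: v) = id.
    by apply/funext => v; rewrite (thinmx0 v) scaler0.
  by rewrite expr0 mul1e.
pose f (p : 'rV[R]_n * measurableTypeR R) : 'rV[R]_n * measurableTypeR R :=
  (c *: p.1, c * p.2).
have mf : measurable_fun setT f.
  apply/measurable_fun_pairP; split.
    rewrite (_ : _ \o _ = (fun v => c *: v) \o fst)//.
    apply: measurableT_comp; last exact: measurable_fst.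
    exact: measurable_fun_homothety.
  rewrite (_ : _ \o _ = (fun v => c * v) \o snd)//.
  by apply: measurableT_comp; [exact: mulrl_measurable|exact: measurable_snd].
have c1 : 0 <= c ^+ n.+1 by rewrite exprn_ge0// ltW.
pose p : {measure set ('rV[R]_n * measurableTypeR R)%type -> \bar R} :=
  (leb n \x @lebesgue_measure R)%E.
pose q : {measure set _ -> \bar R} := pushforward p f.
pose q' : {measure set _ -> \bar R} := mscale (NngNum c1) (q mf).
have mB : measurable (@rV_rcons R n @^-1` A).
  by apply: measurable_preimageT => //; exact: measurable_rV_rcons.
have q'E X : q' X = ((c ^+ n.+1)%:E * p (f @^-1` X))%E by [].
have pq X : measurable X -> p X = q' X.
  apply: product_measure_unique => {}X Y mX mY.
  rewrite q'E (_ : f @^-1` _ =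
    ((fun v => c *: v) @^-1` X) `*` ((fun r : R => c * r) @^-1` Y))//.
  rewrite [X in (_ * X)%E]product_measure1E//; last 2 first.
    by apply: measurable_preimageT => //; exact: measurable_fun_homothety.
    by apply: measurable_preimageT => //; exact: mulrl_measurable.
  rewrite [X in (_ = X * _)%E](IHn X mX).
  rewrite [X in (_ = _ * X)%E](lebesgue_measure_homothety c0 mY).
  by rewrite exprSr EFinM muleACA.
apply: (etrans (pq _ mB)); rewrite q'E; congr (_ * p _)%E.
by apply/seteqP; split => v /=; rewrite rV_rconsZ.
Qed.

End homothety.

(** * Integration along the rays through the origin *)

Section rays.
Context (R : realType) (n : nat).
Local Notation V := 'rV[R]_n.+1.
Local Notation leb := (lebesgue_rV R).
Implicit Types (A : set V) (y : 'rV[R]_n).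

Definition ray_trace A y : set (measurableTypeR R) :=
  [set r | A (r *: rV_rcons (y, 1))].

Lemma measurable_rays A : measurable A ->
  measurable [set p : 'rV[R]_n * measurableTypeR R | ray_trace A p.1 p.2].
Proof.
move=> mA.
pose g (p : 'rV[R]_n * measurableTypeR R) := p.2 *: rV_rcons (p.1, 1).
have mg : measurable_fun setT g.
  apply: measurable_fun_rV => i.
  case: (unliftP ord_max i) => [j|] ->.
  - rewrite (_ : _ \o _ = (fun p : 'rV[R]_n * measurableTypeR R =>
        p.2 * rV_coord j p.1)); last first.
      by apply/funext => p; rewrite /= /rV_coord !mxE liftK.
    apply: measurable_funM; first exact: measurable_snd.
    by apply: measurableT_comp; [exact: measurable_rV_coord|exact: measurable_fst].
  - rewrite (_ : _ \o _ = snd); first exact: measurable_snd.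
    by apply/funext => p; rewrite /= /rV_coord !mxE unlift_none mulr1.
exact: measurable_preimageT mg mA.
Qed.

Lemma measurable_ray_trace A y : measurable A -> measurable (ray_trace A y).
Proof.
move=> /measurable_rays mA.
apply: (@measurable_preimageT _ _ _ _
  (fun r : measurableTypeR R => (y, r)) _ _ mA).
exact: pair1_measurable.
Qed.

(** The slice of [A] at height [r > 0] is the homothetic image, of ratio [r], of
    the set of [y] whose ray meets [A] at the parameter [r].  Integrate the
    measures of the slices over [r] and exchange the two integrals.  The
    measurability of the integrand in [y] comes from the same application of
    Tonelli's theorem. *)
Lemma lebesgue_rV_rays A : measurable A ->
  (forall x, A x -> 0 < x 0 ord_max) ->
  leb n.+1 A = (\int[leb n]_y radial_mass n (ray_trace A y))%E /\
  measurable_fun setT (fun y => radial_mass n (ray_trace A y)).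
Proof.
move=> mA A0.
pose C := [set p : 'rV[R]_n * measurableTypeR R | ray_trace A p.1 p.2]
  `&` (snd @^-1` `]0, +oo[).
have mC : measurable C.
  apply: measurableI; first exact: measurable_rays.
  by apply: measurable_preimageT => //; exact: measurable_snd.
pose f := (fun p : 'rV[R]_n * measurableTypeR R => (p.2 ^+ n)%:E) \_ C.
have mf : measurable_fun setT f.
  apply/(measurable_restrictT _ mC); apply/measurable_EFinP/measurable_funX.
  exact: measurable_funTS measurable_snd.
have f0 p : (0 <= f p)%E.
  rewrite /f patchE; case: ifPn => // /[!inE] -[_ /=].
  by rewrite in_itv/= andbT => /ltW p0; rewrite lee_fin exprn_ge0.
have fE y : radial_mass n (ray_trace A y) =
    (\int[@lebesgue_measure R]_r f (y, r))%E.
  rewrite /radial_mass integral_mkcond; apply: eq_integral => r _.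
  rewrite /f !patchE.
  have -> : (r \in ray_trace A y `&` `]0, +oo[) = ((y, r) \in C).
    by apply/idP/idP; rewrite !inE.
  by [].
have mB : measurable (@rV_rcons R n @^-1` A).
  by apply: measurable_preimageT => //; exact: measurable_rV_rcons.
split; last first.
  under eq_fun do rewrite fE.
  exact: measurable_fun_fubini_tonelli_F.
under eq_integral do rewrite fE.
rewrite fubini_tonelli//.
rewrite [LHS]/lebesgue_rV -/lebesgue_rV /pushforward.
rewrite -(setIT (_ @^-1` A)) -integral_indic// fubini_tonelli2//=; last first.
  exact/measurable_EFinP/measurable_indic.
apply: eq_integral => r _.
rewrite /fubini_G.
have [r0|r0] := ltP 0 r; last first.
  rewrite !integral0_eq// => v _.
    rewrite /f patchE ifF//; apply/negbTE; rewrite notin_setE => -[_ /=].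
    by rewrite in_itv/= andbT ltNge r0.
  rewrite indicE memNset// => /A0; rewrite mxE unlift_none/=.
  by rewrite ltNge r0.
pose S := [set v : 'rV[R]_n | A (rV_rcons (v, r))].
have mS : measurable S.
  apply: (@measurable_preimageT _ _ _ _
    (fun v : 'rV[R]_n => (v, r : measurableTypeR R)) _ _ mB).
  exact: pair2_measurable.
transitivity (leb n S).
  by rewrite -[S]setIT -integral_indic//; apply: eq_integral.
rewrite (lebesgue_rV_homothety r0 mS).
have mS' : measurable ((fun v : 'rV[R]_n => r *: v) @^-1` S).
  by apply: measurable_preimageT => //; exact: measurable_fun_homothety.
rewrite -[X in leb n X]setIT -integral_indic// -ge0_integralZl//; last 2 first.
- exact/measurable_EFinP/measurable_indic.
- by rewrite lee_fin exprn_ge0// ltW.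
apply: eq_integral => v _; rewrite /f patchE indicE.
have -> : (v \in (fun v : 'rV[R]_n => r *: v) @^-1` S) = ((v, r) \in C).
  apply/idP/idP; rewrite !inE /C /S /= /ray_trace /= rV_rconsZ /= mulr1.
    by rewrite in_itv /= r0.
  by case.
by case: ifP => _; rewrite ?mule1 ?mule0.
Qed.

End rays.

(** * Convexity of the covolume *)

Section covolume.
Context (R : realType) (d : nat).
Local Notation V := 'rV[R]_d.+1.
Implicit Types (K D : set V) (y : 'rV[R]_d).
Local Notation posray := `]0%R, +oo[%classic.

Lemma ray_trace_convex K y (x z s : R) : convex_set K ->
  ray_trace K y x -> ray_trace K y z -> 0 < s -> s < 1 ->
  ray_trace K y (s * x + (1 - s) * z).
Proof.
rewrite /ray_trace /= => cK Kx Kz s0 s1.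
have i01 : Itv.spec (@Itv.num_sem R) (Itv.Real `[0%Z, 1%Z]) s.
  by rewrite /= /Itv.num_sem/= num_real/= in_itv/= !ltW.
have := cK _ _ (Itv.mk i01) (mem_set Kx) (mem_set Kz).
by rewrite inE /conv/= !scalerA -scalerDl.
Qed.

Lemma radial_mass_coconvex D K y :
  (forall (c : R) x, 0 < c -> D x -> D (c *: x)) ->
  radial_mass d (ray_trace (D `\` K) y) =
  if rV_rcons (y, 1) \in D
  then radial_mass d (~` (ray_trace K y `&` posray)) else 0%E.
Proof.
move=> coneD; rewrite /radial_mass; case: ifPn => [/set_mem Dy|/negP Dy].
  congr (integral _ _ _); apply/seteqP; split => r /=;
    rewrite in_itv/= andbT => -[+ r0]; rewrite /ray_trace/= => h.
    by split => // -[Kr _]; case: h.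
  split => //; split; first exact: coneD.
  by move=> Kr; apply: h; split => //; rewrite ?in_itv/= r0.
rewrite (_ : _ `&` _ = set0) ?integral_set0//; apply/seteqP; split => // r /=.
rewrite in_itv/= andbT => -[[Dr _] r0]; apply: Dy; rewrite inE.
have rV0 : 0 < r^-1 by rewrite invr_gt0.
by have := coneD _ _ rV0 Dr; rewrite scalerA mulVf ?lt0r_neq0// scale1r.
Qed.

Lemma covolume_rays D K :
  measurable D -> D `<=` future (R:=R) (d:=d) -> measurable K ->
  covolume D K =
    (\int[lebesgue_rV R d]_y radial_mass d (ray_trace (D `\` K) y))%E /\
  measurable_fun setT (fun y => radial_mass d (ray_trace (D `\` K) y)).
Proof.
move=> mD DF mK.
have -> : covolume D K = lebesgue_rV R d.+1 (D `\` K).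
  congr (lebesgue_rV _ _ _); apply/seteqP; split => x; first by case=> -[].
  by case=> Dx nK; split => //; split => //; exact: DF.
apply: lebesgue_rV_rays; first exact: measurableD.
by move=> x [/DF[_ ]].
Qed.

Lemma covolume_convex_lt D K1 K2 (t : R) : 0 < t -> t < 1 ->
  measurable D -> D `<=` future (R:=R) (d:=d) ->
  (forall (c : R) x, 0 < c -> D x -> D (c *: x)) ->
  closed K1 -> closed K2 -> convex_set K1 -> convex_set K2 ->
  (covolume D (minkowski_sum (dilate (1 - t) K1) (dilate t K2))
   <= (1 - t)%:E * covolume D K1 + t%:E * covolume D K2)%E.
Proof.
move=> t0 t1 mD DF coneD clK1 clK2 cK1 cK2.
set K := minkowski_sum _ _.
have mK1 := closed_measurable_rV clK1.
have mK2 := closed_measurable_rV clK2.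
have mK : measurable K by exact: measurable_minkowski_comb.
have [-> f] := covolume_rays mD DF mK.
have [-> f1] := covolume_rays mD DF mK1.
have [-> f2] := covolume_rays mD DF mK2.
have t1' : 0 < 1 - t by rewrite subr_gt0.
have g0 (c : R) A y : 0 < c ->
    (0 <= c%:E * radial_mass d (ray_trace (D `\` A) y))%E.
  by move=> c0; rewrite mule_ge0 ?radial_mass_ge0// lee_fin ltW.
rewrite -!ge0_integralZl//; last 4 first.
- by move=> y _; exact: radial_mass_ge0.
- by rewrite lee_fin ltW.
- by move=> y _; exact: radial_mass_ge0.
- by rewrite lee_fin ltW.
rewrite -ge0_integralD//; last 4 first.
- by move=> y _; exact: g0.
- exact: measurable_funeM.
- by move=> y _; exact: g0.
- exact: measurable_funeM.
apply: ge0_le_integral => //.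
- by move=> y _; exact: radial_mass_ge0.
- by apply: emeasurable_funD; exact: measurable_funeM.
move=> y _; rewrite !radial_mass_coconvex//; case: ifPn => Dy; last first.
  by rewrite !mule0 adde0.
have cvx A : convex_set A -> forall (x z s : R),
    (ray_trace A y `&` posray) x -> (ray_trace A y `&` posray) z ->
    0 < s -> s < 1 -> (ray_trace A y `&` posray) (s * x + (1 - s) * z).
  move=> cA x z s [Ax + ] [Az +] s0 s1.
  rewrite /= !in_itv/= !andbT => x0 z0; split; first exact: ray_trace_convex.
  by rewrite /= ?in_itv/= ?andbT addr_gt0// mulr_gt0// subr_gt0.
have mI A : measurable A -> measurable (ray_trace A y `&` posray).
  by move=> mA; apply: measurableI => //; exact: measurable_ray_trace.
apply: radial_mass_convex => //;
  try exact: mI; try exact: cvx; try by move=> r [].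
move=> r s [Kr + ] [Ks +]; rewrite /= !in_itv/= !andbT => r0 s0.
split; last by rewrite /= ?in_itv/= ?andbT addr_gt0// mulr_gt0.
exists ((1 - t) *: (r *: rV_rcons (y, 1))).
  by exists (r *: rV_rcons (y, 1)).
exists (t *: (s *: rV_rcons (y, 1))); first by exists (s *: rV_rcons (y, 1)).
by rewrite !scalerA -scalerDl.
Qed.

Lemma minkowski_sum_dilate10 K1 K2 : K2 !=set0 ->
  minkowski_sum (dilate 1 K1) (dilate 0 K2) = K1.
Proof.
move=> [y K2y].
apply/seteqP; split=> [x [_ [a K1a <-] [_ [b _ <-] <-]]|x K1x].
  by rewrite scale1r scale0r addr0.
exists (1 *: x); [by exists x|exists (0 *: y); [by exists y|]].
by rewrite scale1r scale0r addr0.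
Qed.

Lemma minkowski_sumC K1 K2 : minkowski_sum K1 K2 = minkowski_sum K2 K1.
Proof.
apply/seteqP; split => x [a Aa [b Bb <-]];
  by exists b => //; exists a => //; rewrite addrC.
Qed.

End covolume.

Theorem theorem5p3 (R : realType) (d : nat) (d_ge1 : (1 <= d)%N)
    (Gamma : set ('rV[R]_d.+1 -> 'rV[R]_d.+1)) (Gamma_fuchsian : fuchsian_group Gamma)
    (D : set 'rV[R]_d.+1) (D_domain : cone_fundamental_domain Gamma D)
    (K1 K2 : set 'rV[R]_d.+1)
    (K1_body : convex_body Gamma K1) (K2_body : convex_body Gamma K2)
    (t : R) (t_ge0 : 0 <= t) (t_le1 : t <= 1) :
  (covolume D (minkowski_sum (dilate (1 - t) K1) (dilate t K2))
   <= (1 - t)%:E * covolume D K1 + t%:E * covolume D K2)%E.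
Proof.
have [K10 cl1 c1 _ _ _] := K1_body; have [K20 cl2 c2 _ _ _] := K2_body.
have [mD DF coneD _ _] := D_domain.
move: t_ge0; rewrite le_eqVlt => /predU1P[<-|t0].
  by rewrite subr0 minkowski_sum_dilate10// mul1e mul0e adde0.
move: t_le1; rewrite le_eqVlt => /predU1P[->|t1].
  rewrite subrr minkowski_sumC minkowski_sum_dilate10//.
  by rewrite mul1e mul0e add0e.
exact: covolume_convex_lt.
Qed.
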